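(* Let $(X,f_{1,\infty})$ be a nonautonomous dynamical system, and let $K$ be a nonempty subset of $X$. (1) If $0<D(f_{1,\infty},K,1)\le h_{top}(f_{1,\infty},K)<+\infty$ and $K$ is $f_{1,\infty}$-invariant, then $D(f_{1,\infty},K)=D_K(f_{1,\infty})=1$ (that is, $D(f_{1,\infty},K)=\underline{D}_K(f_{1,\infty})=\overline{D}_K(f_{1,\infty})=1$). (2) If $0<D(f_{1,\infty},K,1)\le h_{top}(f_{1,\infty},X)<+\infty$, then $D(f_{1,\infty},X)=D_X(f_{1,\infty})=1$ (that is, $D(f_{1,\infty},X)=\underline{D}_X(f_{1,\infty})=\overline{D}_X(f_{1,\infty})=1$).
   Context: A nonautonomous dynamical system (NDS) $(X,f_{1,\infty})$ consists of a compact topological space $X$ and a sequence $f_{1,\infty}=(f_i)_{i\ge 1}$ of continuous maps $f_i:X\to X$. Put $f_i^0=\mathrm{id}_X$, $f_i^j=f_{i+j-1}\circ\cdots\circ f_{i+1}\circ f_i$, and let $f_i^{-j}(A)=(f_i^j)^{-1}(A)$ denote preimages. A subset $K\subseteq X$ is $f_{1,\infty}$-invariant if $f_i^{-1}(K)=K$ for all $i\ge 1$. Classical quantities. For a finite open cover $\mathcal{U}$ of $X$ let $\mathcal{U}_1^n=\bigvee_{j=0}^{n-1}f_1^{-j}(\mathcal{U})$ be the cover of all sets $\bigcap_{j=0}^{n-1}f_1^{-j}(U_j)$ with $U_j\in\mathcal{U}$. For nonempty $K\subseteq X$, let $\mathcal{N}(\mathcal{U}_1^n|_K)$ be the minimal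 number of members of $\{V\cap K: V\in\mathcal{U}_1^n\}$ needed to cover $K$. For $s>0$ set $\overline{h}_K(f_{1,\infty},s)=\sup_{\mathcal{U}}\limsup_{n\to\infty}\frac{1}{n^s}\log\mathcal{N}(\mathcal{U}_1^n|_K)$ and $\underline{h}_K(f_{1,\infty},s)=\sup_{\mathcal{U}}\liminf_{n\to\infty}\frac{1}{n^s}\log\mathcal{N}(\mathcal{U}_1^n|_K)$, suprema over all finite open covers of $X$. The topological entropy is $h_{top}(f_{1,\infty},K)=\overline{h}_K(f_{1,\infty},1)$. The upper and lower topological entropy dimensions are $\overline{D}_K(f_{1,\infty})=\inf\{s>0:\overline{h}_K(f_{1,\infty},s)=0\}=\sup\{s>0:\overline{h}_K(f_{1,\infty},s)=\infty\}$ and $\underline{D}_K(f_{1,\infty})=\inf\{s>0:\underline{h}_K(f_{1,\infty},s)=0\}=\sup\{s>0:\underline{h}_K(f_{1,\infty},s)=\infty\}$. When they coincide, the common value is the classical topological entropy dimension $D_K(f_{1,\infty})$. Pesin quantities. For a finite open cover $\mathcal{U}$ of $X$, let $S(\mathcal{U})$ be the set of all finite strings $\mathbf{U}=(U_{i_0},\dots,U_{i_{m-1}})$ of elements of $\mathcal{U}$, with length $m(\mathbf{U})=m$, and let $X(\mathbf{U})=\{x\in X: f_1^j(x)\in U_{i_j},\ 0\le j\le m(\mathbf{U})-1\}$. A collection $\mathcal{G}\subseteq S(\mathcal{U})$ covers $K$ if $K\subseteq\bigcup_{\mathbf{U}\in\mathcal{G}}X(\mathbf{U})$. For $\alpha\in\mathbb{R}$,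 $s>0$ let $M(f_{1,\infty},K,s,\mathcal{U},\alpha,N)=\inf_{\mathcal{G}}\sum_{\mathbf{U}\in\mathcal{G}}e^{-\alpha m(\mathbf{U})^s}$, the infimum over all finite or countable $\mathcal{G}\subseteq S(\mathcal{U})$ covering $K$ with $m(\mathbf{U})\ge N$ for all $\mathbf{U}\in\mathcal{G}$. Let $m(f_{1,\infty},K,s,\mathcal{U},\alpha)=\lim_{N\to\infty}M(f_{1,\infty},K,s,\mathcal{U},\alpha,N)$, $D(f_{1,\infty},K,s,\mathcal{U})=\inf\{\alpha: m(f_{1,\infty},K,s,\mathcal{U},\alpha)=0\}=\sup\{\alpha: m(f_{1,\infty},K,s,\mathcal{U},\alpha)=\infty\}$, and $D(f_{1,\infty},K,s)=\sup_{\mathcal{U}}D(f_{1,\infty},K,s,\mathcal{U})$ over finite open covers $\mathcal{U}$ (the Pesin $s$-topological entropy). The Pesin topological entropy dimension is $D(f_{1,\infty},K)=\sup\{s>0:D(f_{1,\infty},K,s)=+\infty\}=\inf\{s>0:D(f_{1,\infty},K,s)=0\}$. Conventions for sets of $s>0$: $\inf\emptyset=+\infty$, $\sup\emptyset=0$. *)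

(* Defs.v *)
From HB Require Import structures.
From mathcomp Require Import all_boot all_order all_algebra.
From mathcomp Require Import all_classical all_reals all_analysis.
Set Implicit Arguments.
Unset Strict Implicit.
Unset Printing Implicit Defensive.
Import Order.TTheory GRing.Theory Num.Theory.
Local Open Scope classical_set_scope.
Local Open Scope card_scope.
Local Open Scope ring_scope.

(* The sequence f_1, f_2, ... is a function on nat read at indices i >= 1;
   the value f 0 is never used. *)

(* f_i^j = f_(i+j-1) o ... o f_(i+1) o f_i, the identity for j = 0. *)
Fixpoint nds_iter (X : Type) (f : nat -> X -> X) (i j : nat) : X -> X :=
  if j is j'.+1 then f (i + j')%N \o nds_iter f i j' else id.

Definition nds_invariant (X : Type) (f : nat -> X -> X) (K : set X) : Prop :=
  forall i, (1 <= i)%N -> f i @^-1` K = K.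

Definition finite_open_cover (X : topologicalType) (U : set (set X)) : Prop :=
  [/\ finite_set U, (forall A, U A -> open A) & \bigcup_(A in U) A = [set: X]].

Definition join_cover (X : Type) (f : nat -> X -> X) (U : set (set X))
    (n : nat) : set (set X) :=
  [set V | exists u : nat -> set X, (forall j, (j < n)%N -> U (u j)) /\
           V = \bigcap_(j in `I_n) (nds_iter f 1 j @^-1` u j)].

(* The infimum is over a set of natural numbers; it is a minimum as soon as
   that set is nonempty, e.g., when W is a finite cover of X. *)
Definition covering_number (R : realType) (X : Type) (W : set (set X))
    (K : set X) : R :=
  inf [set m%:R | m in [set m : nat | exists F : set (set X),
    [/\ F `<=` [set V `&` K | V in W], F #= `I_m &
        K `<=` \bigcup_(A in F) A]]].

Section Entropy.
Variables (R : realType) (X : topologicalType).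
Implicit Types (f : nat -> X -> X) (K : set X) (U : set (set X)) (s alpha : R).
Local Open Scope ereal_scope.

Definition entropy_rate f K s U (n : nat) : \bar R :=
  ((n%:R `^ s)^-1 * ln (covering_number R (join_cover f U n) K))%:E.

Definition upper_entropy f K s : \bar R :=
  ereal_sup [set limn_esup (entropy_rate f K s U)
            | U in @finite_open_cover X].

Definition lower_entropy f K s : \bar R :=
  ereal_sup [set limn_einf (entropy_rate f K s U)
            | U in @finite_open_cover X].

Definition topological_entropy f K : \bar R := upper_entropy f K 1%R.

(* The entropies and Pesin measures below are critical-exponent quantities:
   they drop from +oo to 0 at a single value.  That value is written as the
   infimum of the exponents giving 0, except for pesin_entropy_dim, where it is
   the supremum of the exponents giving +oo. *)
Definition upper_entropy_dim f K : \bar R :=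
  ereal_inf [set s%:E | s in [set s : R | (0 < s)%R /\
                                          upper_entropy f K s = 0]].

Definition lower_entropy_dim f K : \bar R :=
  ereal_inf [set s%:E | s in [set s : R | (0 < s)%R /\
                                          lower_entropy f K s = 0]].

Definition string_set f (u : seq (set X)) : set X :=
  [set x | forall j, (j < size u)%N -> nth [set: X] u j (nds_iter f 1 j x)].

Definition string_covering f K U (N : nat) (G : set (seq (set X))) : Prop :=
  [/\ countable G,
      (forall u, G u -> forall A, A \in u -> U A),
      (forall u, G u -> (N <= size u)%N) &
      K `<=` \bigcup_(u in G) string_set f u].

(* esum over a countable G is the (order-independent) sum of a nonnegative
   family, possibly +oo. *)
Definition pesin_sum f K s U alpha (N : nat) : \bar R :=
  ereal_inf [set \esum_(u in G) (expR (- alpha * (size u)%:R `^ s))%:E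
            | G in string_covering f K U N].

(* pesin_sum is nondecreasing in N, so the limit exists in \bar R. *)
Definition pesin_measure f K s U alpha : \bar R :=
  limn (pesin_sum f K s U alpha).

Definition pesin_entropy_cover f K s U : \bar R :=
  ereal_inf [set alpha%:E | alpha in [set alpha : R |
                                      pesin_measure f K s U alpha = 0]].

Definition pesin_entropy f K s : \bar R :=
  ereal_sup [set pesin_entropy_cover f K s U | U in @finite_open_cover X].

(* The outer maximum implements the convention sup set0 = 0 for sets of
   positive reals, since ereal_sup set0 = -oo. *)
Definition pesin_entropy_dim f K : \bar R :=
  maxe 0 (ereal_sup [set s%:E | s in [set s : R | (0 < s)%R /\
                                      pesin_entropy f K s = +oo]]).

End Entropy.

Arguments topological_entropy R {X} f K.
Arguments upper_entropy_dim R {X} f K.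
Arguments lower_entropy_dim R {X} f K.
Arguments pesin_entropy_dim R {X} f K.

(* Main.v *)
Require Import Defs.
From mathcomp Require Import all_boot all_order all_algebra.
From mathcomp Require Import all_classical all_reals all_analysis.
From mathcomp Require Import lra.
Import Order.TTheory GRing.Theory Num.Theory.
Local Open Scope classical_set_scope.
Local Open Scope ring_scope.
Local Open Scope ereal_scope.

(** Under the hypotheses, [t = 1] is the critical exponent of the Pesin, lower
    and upper entropies at once: at positive exponents, each of them is [+oo]
    below it and [0] above it. Write [N_n] for the covering number of [K] by the
    [n]-th join of a cover [U].

    To the right of [t], dividing a bounded rate [n^-t ln N_n] by the extra
    factor [n^(s-t)], which tends to infinity, gives [0]: a finite upper entropy
    at [t] forces the upper entropy to vanish at every [s > t]
    ([upper_entropy_eq0]).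

    To the left of [t], a string of length [m] has weight [exp(- b m^s)], which
    exceeds [exp(- a m^t)] for all long strings as soon as [a > 0] and [s < t],
    whatever [b] is. So if the Pesin measure at exponent [t] is positive for
    some [a > 0], it is positive at exponent [s] for every [b], and the Pesin
    entropy at [s] is [+oo] ([pesin_entropy_eqy]).

    These two facts meet through the comparison
      pesin_entropy <= lower_entropy <= upper_entropy,
    valid at every positive exponent. Its first half holds because a minimal
    subcover of [K] by members of the [n]-th join of [U] is also a covering of
    [K] by strings of length [n] ([pesin_sum_le_covering_number]). Hence
    positivity of the Pesin entropy and finiteness of the upper entropy at [t]
    determine all three entropies at all other exponents, and all three
    dimensions equal [t] ([entropy_dims_eq]).

    For the second assertion, the Pesin entropy is monotone in the set
    ([pesin_entropy_mono]), so its positivity passes from [K] to the whole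
    space, to which the previous argument applies. *)

Set Implicit Arguments.
Unset Strict Implicit.

(** * Growth of powers, upper and lower limits *)

Lemma powR_nat_ge (R : realType) (a C : R) : (0 < a)%R ->
  \forall n \near \oo, (C <= n%:R `^ a)%R.
Proof.
move=> a0; near=> n.
have Cn : (`|C| `^ a^-1 <= n%:R)%R by near: n; exact: nbhs_infty_ger.
apply: le_trans (ler_norm C) _.
have -> : `|C|%R = ((`|C| `^ a^-1) `^ a)%R.
  by rewrite -powRrM mulVf ?gt_eqF// powRr1.
by apply: ge0_ler_powR; rewrite ?nnegrE ?powR_ge0 ?ler0n// ltW.
Unshelve. all: by end_near. Qed.

Lemma limn_esup_near_lt (R : realType) (u : (\bar R)^nat) (x : \bar R) :
  limn_esup u < x -> \forall n \near \oo, u n < x.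
Proof.
rewrite limn_esup_lim (cvg_lim _ (@cvg_esups_inf _ u))//.
move=> /ereal_inf_lt[_ [N _ <-] uNx]; exists N => // n /= Nn.
by apply: le_lt_trans uNx; apply: ereal_sup_ubound; exists n.
Qed.

Lemma limn_esup_near_le (R : realType) (u : (\bar R)^nat) (x : \bar R) :
  (\forall n \near \oo, u n <= x) -> limn_esup u <= x.
Proof.
rewrite limn_esup_lim (cvg_lim _ (@cvg_esups_inf _ u))// => -[N _ ux].
apply: (@le_trans _ _ (esups u N)); first by apply: ereal_inf_lbound; exists N.
by apply: ge_ereal_sup => _ [n /= Nn <-]; exact: ux.
Qed.

Lemma limn_einf_frequently_lt (R : realType) (u : (\bar R)^nat) (x : \bar R)
    (N : nat) : limn_einf u < x -> exists2 n, (N <= n)%N & u n < x.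
Proof.
rewrite limn_einf_lim (cvg_lim _ (@cvg_einfs_sup _ u))// => ux.
have : einfs u N < x.
  by apply: le_lt_trans ux; apply: ereal_sup_ubound; exists N.
by move=> /ereal_inf_lt[_ [n /= Nn <-] unx]; exists n.
Qed.

(** * Covering numbers *)

(** The infimum defining a covering number is attained, by well-ordering of the
    natural numbers. *)
Lemma inf_natr_mem (R : realType) (P : set nat) : P !=set0 ->
  exists2 m, P m & inf [set (k%:R : R)%R | k in P] = m%:R.
Proof.
move=> [k Pk].
have exP : exists k, `[< P k >] by exists k; exact/asboolP.
case: (ex_minnP exP) => m /asboolP Pm minm.
have lb : lbound [set (k%:R : R)%R | k in P] m%:R.
  by move=> _ [j Pj <-]; rewrite ler_nat minm//; exact/asboolP.
exists m => //; apply/eqP; rewrite eq_le; apply/andP; split.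
  by apply: ge_inf; [exists m%:R | exists m].
by apply: lb_le_inf => //; exists m%:R, m.
Qed.

(** When finitely many members of [W] never cover [K], the infimum is that of
    the empty set, namely [0], and [ln 0 = 0] as well. *)
Lemma covering_number_ln_ge0 (R : realType) (X : Type) (W : set (set X))
    (K : set X) : (0 <= ln (covering_number R W K))%R.
Proof.
rewrite /covering_number; set P := (X in inf [set _ | _ in X]).
have [->|/set0P/(inf_natr_mem R)[m _ ->]] := eqVneq P set0.
  by rewrite image_set0 inf0 ln0.
case: m => [|m]; first by rewrite ln0.
by rewrite ln_ge0// ler1n.
Qed.

Lemma covering_numberP (R : realType) (X : Type) (W : set (set X))
    (K : set X) : finite_set W -> K `<=` \bigcup_(V in W) V ->
  exists (m : nat) (F : set (set X)), [/\ F `<=` [set V `&` K | V in W],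
    (F #= `I_m)%card, K `<=` \bigcup_(A in F) A &
    covering_number R W K = m%:R].
Proof.
move=> finW KW; rewrite /covering_number; set P := (X in inf [set _ | _ in X]).
have [|m [F [FW Fm KF]] ->] := @inf_natr_mem R P; last by exists m, F.
have /finite_setP[m Fm] : finite_set [set V `&` K | V in W].
  exact: finite_image.
exists m, [set V `&` K | V in W]; split=> // x Kx.
by have [V WV Vx] := KW x Kx; exists (V `&` K) => //; exists V.
Qed.

Section Nonautonomous.
Variables (R : realType) (X : topologicalType).
Implicit Types (f : nat -> X -> X) (K : set X) (U : set (set X)).
Implicit Types (s t a : R).

(** By induction: the members of the join of length [n + 1] are intersections of
    one of length [n] with one of the preimages of the members of [U]. *)
Lemma join_cover_finite f U n : finite_set U -> finite_set (join_cover f U n).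
Proof.
move=> finU; elim: n => [|n IHn].
  apply: (sub_finite_set _ (finite_set1 [set: X])) => V [u [_ ->]] /=.
  by rewrite II0 bigcap_set0.
pose cut V A := V `&` (nds_iter f 1 n @^-1` A) : set X.
apply: (sub_finite_set _ (finite_image2 cut IHn finU)) => V [u [Uu ->]].
exists (\bigcap_(j in `I_n) (nds_iter f 1 j @^-1` u j)).
  by exists u; split=> // j jn; apply: Uu; exact: ltnW.
exists (u n); first exact: Uu.
rewrite /cut; apply/seteqP; split=> x /= => [[ux un] j /=|ux].
  by rewrite ltnS leq_eqVlt => /predU1P[->//|/ux].
by split=> [j /ltnW/ux//|]; exact: (ux n (ltnSn n)).
Qed.

Lemma join_cover_covers f U n : \bigcup_(A in U) A = [set: X] ->
  \bigcup_(V in join_cover f U n) V = [set: X].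
Proof.
move=> UX; rewrite -subTset => x _.
have /choice[u uP] : forall j, exists A, U A /\ A (nds_iter f 1 j x).
  move=> j; have : [set: X] (nds_iter f 1 j x) by [].
  by rewrite -UX => -[A UA Ax]; exists A.
exists (\bigcap_(j in `I_n) (nds_iter f 1 j @^-1` u j)).
  by exists u; split=> // j _; have [] := uP j.
by move=> j _; have [] := uP j.
Qed.

Lemma join_cover_string f U n V : join_cover f U n V ->
  exists u : seq (set X), [/\ size u = n, forall A, A \in u -> U A &
    string_set f u = V].
Proof.
move=> [v [Uv ->]]; exists (mkseq v n); split; first by rewrite size_mkseq.
  by move=> A /mapP[j]; rewrite mem_iota => /= jn ->; exact: Uv.
apply/seteqP; split=> x /= vx j; rewrite ?size_mkseq => jn.
  by have := vx j; rewrite size_mkseq nth_mkseq//; apply.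
by rewrite nth_mkseq//; exact: vx.
Qed.

(** * Pesin sums and Pesin measures *)

Lemma pesin_sum_ge0 f K s U a N : 0 <= pesin_sum f K s U a N.
Proof.
apply: le_ereal_inf_tmp => _ [G _ <-]; apply: esum_ge0 => u _.
by rewrite lee_fin expR_ge0.
Qed.

Lemma nondecreasing_pesin_sum f K s U a :
  nondecreasing_seq (pesin_sum f K s U a).
Proof.
move=> N N' NN'; apply: ereal_inf_le_tmp => _ [G [cG GU GN' KG] <-].
exists G => //; split=> // u Gu; exact: leq_trans (GN' _ Gu).
Qed.

Lemma pesin_sum_is_cvg f K s U a : cvgn (pesin_sum f K s U a).
Proof.
exact/ereal_nondecreasing_is_cvgn/nondecreasing_pesin_sum.
Qed.

Lemma pesin_measure_ge0 f K s U a : 0 <= pesin_measure f K s U a.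
Proof.
apply: lime_ge; first exact: pesin_sum_is_cvg.
by apply: nearW => N; exact: pesin_sum_ge0.
Qed.

(** Each member of a minimal subcover is the restriction to [K] of the set of a
    string of length [n]; these strings form an admissible covering, all of
    whose terms are equal. *)
Lemma pesin_sum_le_covering_number f K s U a n : finite_open_cover U ->
  pesin_sum f K s U a n <=
  (covering_number R (join_cover f U n) K * expR (- a * n%:R `^ s))%:E.
Proof.
move=> [finU _ UX].
have [||m [F [FW Fm KF ->]]] :=
    @covering_numberP R _ (join_cover f U n) K.
- exact: join_cover_finite.
- by rewrite join_cover_covers.
move: Fm; rewrite card_eq_sym => /card_set_bijP[e [eF einj esurj]].
have /choice[w wP] : forall i, exists u : seq (set X), (i < m)%N ->
    [/\ size u = n, forall A, A \in u -> U A & string_set f u `&` K = e i].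
  move=> i; have [im|] := boolP (i < m)%N; last by exists [::].
  have [V /join_cover_string[u [un uU <-]] <-] := FW _ (eF i im).
  by exists u.
(* Distinct pieces have distinct strings, so that no term of the sum over the
   strings is counted for two pieces. *)
have winj : set_inj `I_m w.
  move=> i j; rewrite !inE /= => im jm wij.
  apply: einj; rewrite ?inE//.
  by have [_ _ <-] := wP i im; have [_ _ <-] := wP j jm; rewrite wij.
have covw : string_covering f K U n (w @` `I_m).
  split.
  - exact/finite_set_countable/finite_image/finite_II.
  - by move=> _ [i im <-]; have [_ + _] := wP i im.
  - by move=> _ [i im <-]; have [-> _ _] := wP i im.
  - move=> x Kx; have [A FA Ax] := KF x Kx.
    have [i im eiA] := esurj A FA; exists (w i); first by exists i.
    by move: Ax; rewrite -eiA; have [_ _ <-] := wP i im => -[].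
apply: le_trans (ereal_inf_lbound (ex_intro2 _ _ _ covw erefl)) _.
rewrite esum_image// (@eq_esum _ _ _ _
  (fun=> (expR (- a * n%:R `^ s))%:E)); last first.
  by move=> i im; have [-> _ _] := wP i im.
rewrite esum_fset ?finite_II//.
by rewrite -fsbig_ord sumEFin sumr_const card_ord -[(expR _ *+ _)%R]mulr_natl.
Qed.

(** There are arbitrarily large [n] with [N_n <= exp(b n^s)], for which the
    Pesin sum is at most [exp(- (a - b) n^s)]; as Pesin sums increase with the
    minimal length, all of them vanish. *)
Lemma pesin_measure_eq0 f K s U a b : (0 < s)%R -> finite_open_cover U ->
  (b < a)%R -> limn_einf (entropy_rate f K s U) < b%:E ->
  pesin_measure f K s U a = 0.
Proof.
move=> s0 covU ba Lb; apply/eqP; rewrite eq_le pesin_measure_ge0 andbT.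
apply: lime_le; first exact: pesin_sum_is_cvg.
apply: nearW => N; apply/lee_addgt0Pr => eps eps0; rewrite add0e.
(* The second bound makes exp(- (a - b) n^s) at most eps; the bound by 1 makes
   n^s positive, which excludes n = 0. *)
have [n [Nn large rn]] : exists n, [/\ (N <= n)%N,
    (Num.max 1 (- ln eps / (a - b)) <= n%:R `^ s)%R &
    entropy_rate f K s U n < b%:E].
  have [M _ largeM] := powR_nat_ge (Num.max 1 (- ln eps / (a - b)))%R s0.
  have [n] := limn_einf_frequently_lt (maxn N M) Lb.
  by rewrite geq_max => /andP[Nn Mn] rn; exists n; split=> //; exact: largeM.
move: large; rewrite ge_max => /andP[large1 large2].
have ns0 : (0 < n%:R `^ s)%R by exact: lt_le_trans large1.
apply: le_trans (nondecreasing_pesin_sum f K s U a Nn) _.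
apply: le_trans (pesin_sum_le_covering_number f K s a n covU) _.
rewrite lee_fin.
set c := covering_number _ _ _.
(* A covering number 0 has logarithm 0, hence is treated apart. *)
have cb : (c <= expR (b * n%:R `^ s))%R.
  have [c0|c0] := leP c 0%R; first exact: le_trans c0 (expR_ge0 _).
  rewrite -[leLHS]lnK ?posrE// ler_expR.
  by move: rn; rewrite /entropy_rate lte_fin mulrC ltr_pdivrMr// => /ltW.
apply: (@le_trans _ _ (expR (b * n%:R `^ s) * expR (- a * n%:R `^ s))%R).
  by rewrite ler_wpM2r// expR_ge0.
rewrite -expRD -mulrDl -[leRHS]lnK ?posrE// ler_expR.
by move: large2; rewrite ler_pdivrMr ?subr_gt0//; nra.
Qed.

(** * Comparison of the three entropies *)

Lemma entropy_rate_ge0 f K s U n : 0 <= entropy_rate f K s U n.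
Proof.
by rewrite lee_fin mulr_ge0 ?invr_ge0 ?powR_ge0 ?covering_number_ln_ge0.
Qed.

Lemma limn_einf_entropy_rate_ge0 f K s U :
  0 <= limn_einf (entropy_rate f K s U).
Proof.
rewrite limn_einf_lim; apply: lime_ge; first exact: is_cvg_einfs.
apply: nearW => n; apply: le_ereal_inf_tmp => _ [k _ <-].
exact: entropy_rate_ge0.
Qed.

Lemma pesin_entropy_cover_le f K s U : (0 < s)%R -> finite_open_cover U ->
  pesin_entropy_cover f K s U <= limn_einf (entropy_rate f K s U).
Proof.
move=> s0 covU.
case: (limn_einf _) (limn_einf_entropy_rate_ge0 f K s U)
  (@pesin_measure_eq0 f K s U) => [l||] // _ mE; last exact: leey.
apply/lee_addgt0Pr => eps eps0; apply: ereal_inf_lbound.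
exists (l + eps)%R => //; apply: (mE _ (l + eps / 2)%R) => //.
  by lra.
by rewrite lte_fin; lra.
Qed.

Lemma pesin_entropy_le_lower f K s : (0 < s)%R ->
  pesin_entropy f K s <= lower_entropy f K s.
Proof.
move=> s0; apply: ge_ereal_sup => _ [U covU <-].
apply: le_trans (pesin_entropy_cover_le f K s0 covU) _.
by apply: ereal_sup_ubound; exists U.
Qed.

Lemma lower_entropy_le_upper f K s :
  lower_entropy f K s <= upper_entropy f K s.
Proof.
apply: ge_ereal_sup => _ [U covU <-].
apply: le_trans (limn_einf_sup _) _.
by apply: ereal_sup_ubound; exists U.
Qed.

Lemma finite_open_cover_setT : finite_open_cover [set [set: X]].
Proof.
split; [exact: finite_set1 | | by rewrite bigcup_set1].
by move=> _ ->; exact: openT.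
Qed.

Lemma lower_entropy_ge0 f K s : 0 <= lower_entropy f K s.
Proof.
apply: (@le_trans _ _ (limn_einf (entropy_rate f K s [set [set: X]]))).
  exact: limn_einf_entropy_rate_ge0.
by apply: ereal_sup_ubound; exists [set [set: X]] => //;
  exact: finite_open_cover_setT.
Qed.

(** * Jumps of the entropies at a critical exponent *)

(** Eventually [ln N_n <= C n^t], and [C n^t <= eps n^s] as soon as
    [n^(s - t) >= C / eps]. *)
Lemma upper_entropy_eq0 f K s t : (t < s)%R -> upper_entropy f K t < +oo ->
  upper_entropy f K s = 0.
Proof.
move=> ts finH; apply/eqP; rewrite eq_le; apply/andP; split; last first.
  exact: le_trans (lower_entropy_ge0 f K s) (lower_entropy_le_upper f K s).
apply: ge_ereal_sup => _ [U covU <-].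
have Lfin : limn_esup (entropy_rate f K t U) < +oo.
  by apply: le_lt_trans finH; apply: ereal_sup_ubound; exists U.
have [C C0 rC] : exists2 C : R, (0 < C)%R &
    limn_esup (entropy_rate f K t U) < C%:E.
  move: (limn_esup _) Lfin => [l||]// _.
    have := ler_norm l; have := normr_ge0 l => l0 ll.
    by exists (`|l| + 1)%R; rewrite ?lte_fin; lra.
  by exists 1%R; rewrite ?ltNyr.
apply/lee_addgt0Pr => eps eps0; rewrite add0e.
apply: limn_esup_near_le; near=> n.
have n0 : (0 < n)%N by near: n; exact: nbhs_infty_gt.
have : entropy_rate f K t U n < C%:E by near: n; exact: limn_esup_near_lt.
have : (C / eps <= n%:R `^ (s - t))%R.
  by near: n; apply: powR_nat_ge; rewrite subr_gt0.
rewrite powRB ?pnatr_eq0 -?lt0n ?n0 ?implybT// /entropy_rate !lee_fin lte_fin.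
have : (0 < n%:R `^ s :> R)%R by rewrite powR_gt0// ltr0n.
have : (0 < n%:R `^ t :> R)%R by rewrite powR_gt0// ltr0n.
move: (ln _) (n%:R `^ s)%R (n%:R `^ t)%R => l p q q0 p0.
rewrite ler_pdivlMr// mulrAC ler_pdivrMr// => large.
rewrite ![(_^-1 * l)%R]mulrC ltr_pdivrMr// ler_pdivrMr//.
by nra.
Unshelve. all: by end_near. Qed.

(** For long strings [b m^s <= a m^t], so the weights at exponent [s] dominate
    those at exponent [t]: no [b] gives measure [0] at exponent [s], and the
    infimum of the empty set is [+oo]. *)
Lemma pesin_entropy_eqy f K s t : (s < t)%R -> 0 < pesin_entropy f K t ->
  pesin_entropy f K s = +oo.
Proof.
move=> st /ereal_sup_gt[_ [U covU <-] D0].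
have [a a0 aD] : exists2 a : R, (0 < a)%R & a%:E < pesin_entropy_cover f K t U.
  move: D0; case: (pesin_entropy_cover _ _ _ _) => [d||]//.
    by rewrite lte_fin => d0; exists (d / 2)%R; rewrite ?lte_fin; lra.
  by exists 1%R; rewrite ?ltry.
have m0 : 0 < pesin_measure f K t U a.
  rewrite lt_neqAle pesin_measure_ge0 andbT; apply/eqP => m0.
  move: aD; apply/negP; rewrite -leNgt; apply: ereal_inf_lbound.
  by exists a.
apply/eqP; rewrite eq_le leey /=.
apply: le_trans (ereal_sup_ubound (ex_intro2 _ _ _ covU erefl)).
apply: le_ereal_inf_tmp => _ [b /= mb <-]; exfalso.
suff : pesin_measure f K t U a <= pesin_measure f K s U b.
  by rewrite mb leNgt m0.
apply: lee_lim; try exact: pesin_sum_is_cvg.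
have [M _ large] : \forall n \near \oo, (b / a <= n%:R `^ (t - s))%R.
  by apply: powR_nat_ge; rewrite subr_gt0.
near=> N; apply: le_ereal_inf_tmp => _ [G covG <-].
have [_ _ GN _] := covG.
apply: le_trans (ereal_inf_lbound (ex_intro2 _ _ _ covG erefl)) _.
apply: le_esum => u Gu; rewrite lee_fin ler_expR.
have Nu : (N <= size u)%N by exact: GN.
have u0 : (0 < size u)%N.
  by apply: leq_trans Nu; near: N; exact: nbhs_infty_gt.
have : (b / a <= (size u)%:R `^ (t - s))%R.
  by apply: large => /=; apply: leq_trans Nu; near: N; exact: nbhs_infty_ge.
have us0 : (0 < (size u)%:R `^ s :> R)%R by rewrite powR_gt0// ltr0n.
rewrite powRB; last by rewrite pnatr_eq0 -lt0n u0 implybT.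
rewrite ler_pdivrMr// mulrAC ler_pdivlMr//.
by nra.
Unshelve. all: by end_near. Qed.

(** A covering of the larger set is a covering of the smaller one. *)
Lemma pesin_entropy_mono f K K' s : K `<=` K' ->
  pesin_entropy f K s <= pesin_entropy f K' s.
Proof.
move=> KK'; apply: ge_ereal_sup => _ [U covU <-].
apply: le_trans (ereal_sup_ubound (ex_intro2 _ _ _ covU erefl)).
apply: ereal_inf_le_tmp => _ [a /= mK'0 <-]; exists a => //=.
apply/eqP; rewrite eq_le pesin_measure_ge0 andbT -mK'0.
apply: lee_lim; try exact: pesin_sum_is_cvg.
apply: nearW => N; apply: ereal_inf_le_tmp => _ [G [cG GU GN K'G] <-].
by exists G => //; split=> //; exact: subset_trans K'G.
Qed.

(** * Entropy dimensions *)

Lemma ereal_inf_cut (P : R -> Prop) t : (forall s, (t < s)%R -> P s) ->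
  (forall s, P s -> (t <= s)%R) -> ereal_inf [set s%:E | s in P] = t%:E.
Proof.
move=> Pgt Pge; apply/eqP; rewrite eq_le; apply/andP; split.
  apply/lee_addgt0Pr => eps eps0; apply: ereal_inf_lbound.
  by exists (t + eps)%R => //; apply: Pgt; rewrite ltrDl.
by apply: le_ereal_inf_tmp => _ [s Ps <-]; rewrite lee_fin; exact: Pge.
Qed.

(** At positive exponents, all three entropies are [+oo] below [t] and finite
    above [t], where the lower and upper ones are [0]; the infima and the
    supremum are therefore [t], whether or not they are attained. *)
Lemma entropy_dims_eq f K t : (0 < t)%R ->
  0 < pesin_entropy f K t -> upper_entropy f K t < +oo ->
  [/\ pesin_entropy_dim R f K = t%:E, lower_entropy_dim R f K = t%:E &
      upper_entropy_dim R f K = t%:E].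
Proof.
move=> t0 P0 Hfin.
have Hs0 s : (t < s)%R -> upper_entropy f K s = 0.
  by move=> ts; exact: upper_entropy_eq0 ts Hfin.
have Ls0 s : (t < s)%R -> lower_entropy f K s = 0.
  move=> ts; apply/eqP; rewrite eq_le lower_entropy_ge0 andbT -(Hs0 s ts).
  exact: lower_entropy_le_upper.
have Psy s : (s < t)%R -> pesin_entropy f K s = +oo.
  by move=> st; exact: pesin_entropy_eqy st P0.
have Lsy s : (0 < s)%R -> (s < t)%R -> lower_entropy f K s = +oo.
  move=> s0 st; apply/eqP; rewrite eq_le leey -(Psy s st).
  exact: pesin_entropy_le_lower.
have Hsy s : (0 < s)%R -> (s < t)%R -> upper_entropy f K s = +oo.
  move=> s0 st; apply/eqP; rewrite eq_le leey -(Lsy s s0 st).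
  exact: lower_entropy_le_upper.
split.
- rewrite /pesin_entropy_dim; apply/eqP; rewrite eq_le; apply/andP; split.
    rewrite ge_max lee_fin ltW//=.
    apply: ge_ereal_sup => _ [s [s0 Ps] <-]; rewrite lee_fin leNgt.
    apply/negP => ts; have := pesin_entropy_le_lower f K s0.
    by rewrite Ps Ls0.
  rewrite le_max; apply/orP; right; apply/lee_addgt0Pr => eps eps0.
  (* Exponents of the supremum must be positive, whence the maximum with
     t / 2. *)
  pose s := Num.max (t - eps)%R (t / 2)%R.
  have [s0 st ets] : [/\ (0 < s)%R, (s < t)%R & (t - eps <= s)%R].
    by rewrite lt_max gt_max le_max lexx; split=> //; lra.
  apply: (@le_trans _ _ (s%:E + eps%:E)); first by rewrite lee_fin; lra.
  rewrite leeD2r//; apply: ereal_sup_ubound; exists s => //.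
  by split=> //; exact: Psy.
- apply: ereal_inf_cut => s; first by
    move=> ts; split; [exact: lt_trans ts | exact: Ls0].
  move=> [s0 Ls]; rewrite leNgt; apply/negP => st.
  by move: Ls; rewrite Lsy.
- apply: ereal_inf_cut => s; first by
    move=> ts; split; [exact: lt_trans ts | exact: Hs0].
  move=> [s0 Hs]; rewrite leNgt; apply/negP => st.
  by move: Hs; rewrite Hsy.
Qed.

End Nonautonomous.

Unset Implicit Arguments.

Theorem theorem4p8 (R : realType) (X : topologicalType) (f : nat -> X -> X)
    (K : set X)
    (X_compact : compact [set: X])
    (f_continuous : forall i, (1 <= i)%N -> continuous (f i))
    (K_nonempty : K !=set0) :
  (0 < pesin_entropy f K (1%R : R) ->
   pesin_entropy f K (1%R : R) <= topological_entropy R f K ->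
   topological_entropy R f K < +oo ->
   nds_invariant f K ->
   [/\ pesin_entropy_dim R f K = 1,
       lower_entropy_dim R f K = 1 &
       upper_entropy_dim R f K = 1])
  /\
  (0 < pesin_entropy f K (1%R : R) ->
   pesin_entropy f K (1%R : R) <= topological_entropy R f [set: X] ->
   topological_entropy R f [set: X] < +oo ->
   [/\ pesin_entropy_dim R f [set: X] = 1,
       lower_entropy_dim R f [set: X] = 1 &
       upper_entropy_dim R f [set: X] = 1]).
Proof.
split=> [P0 _ Hfin _|P0 _ Hfin]; first exact: entropy_dims_eq Hfin.
apply: entropy_dims_eq Hfin => //.
by apply: lt_le_trans P0 _; exact: pesin_entropy_mono.
Qed.
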